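(* Let $r,s\geq 1$, $n\geq 2$ be integers. (a) If $r\neq s$ then $\beta(H(r,n,s)^{\mathrm{ab}})=\gcd(r,n,s)-1$; (b) if $r=s$ then $\beta(H(r,n,s)^{\mathrm{ab}})=\gcd(r,n)$.
   Context: For integers $r,s\geq 1$, $n\geq 2$, the generalized Fibonacci group $H(r,n,s)$ is the group with generators $x_0,\ldots,x_{n-1}$ and defining relations $x_i x_{i+1}\cdots x_{i+r-1}=x_{i+r}x_{i+r+1}\cdots x_{i+r+s-1}$ for $0\leq i<n$, with subscripts taken mod $n$. $G^{\mathrm{ab}}$ denotes the abelianization of a group $G$. For a finitely generated abelian group $A\cong A_0\oplus\mathbb{Z}^\beta$ with $A_0$ finite, $\beta(A)=\beta$ denotes its Betti number (torsion-free rank). *)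

(* Defs.v *)
From HB Require Import structures.
From mathcomp Require Import all_boot all_order all_algebra.
From mathcomp Require Import boolp.

Set Implicit Arguments.
Unset Strict Implicit.
Unset Printing Implicit Defensive.

(* The letters (x, false) and (x, true) stand for x and x^-1. *)
Definition word (I : Type) : Type := seq (I * bool).

Section Presentation.
Variables (I : choiceType) (rels : word I -> word I -> Prop).

Inductive word_equiv : word I -> word I -> Prop :=
| word_equiv_refl u : word_equiv u u
| word_equiv_sym u v : word_equiv u v -> word_equiv v u
| word_equiv_trans u v w : word_equiv u v -> word_equiv v w -> word_equiv u w
| word_equiv_cat u u' v v' :
    word_equiv u u' -> word_equiv v v' -> word_equiv (u ++ v) (u' ++ v')
| word_equiv_cancel x b : word_equiv [:: (x, b); (x, ~~ b)] [::]
| word_equiv_rel u v : rels u v -> word_equiv u v.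

Definition word_equivb (u v : word I) : bool := `[< word_equiv u v >].

Fact word_equivb_equiv : equiv_class_of word_equivb.
Proof.
split=> [u | u v | v u w].
- by apply/asboolP; apply: word_equiv_refl.
- by apply/asboolP/asboolP; apply: word_equiv_sym.
- by move=> /asboolP uv /asboolP vw; apply/asboolP; apply: word_equiv_trans uv vw.
Qed.

Canonical word_equiv_rel_class :=
  EquivRelPack word_equivb_equiv.

(* The group < I | u = v whenever rels u v >. *)
Definition presented : Type := {eq_quot word_equivb}%qT.

HB.instance Definition _ := Choice.on presented.
HB.instance Definition _ := EqQuotient.on presented.

Definition word_inv (u : word I) : word I :=
  rev [seq (a.1, ~~ a.2) | a <- u].

Definition word_class (u : word I) : presented := (\pi_presented u)%qT.

Definition presented_one : presented := word_class [::].
Definition presented_mul (g h : presented) : presented := word_class (repr g ++ repr h).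
Definition presented_inv (g : presented) : presented :=
  word_class (word_inv (repr g)).

Lemma word_reprK g : word_class (repr g) = g.
Proof. exact: reprK. Qed.

Lemma word_class_ind (P : presented -> Prop) :
  (forall u, P (word_class u)) -> forall g, P g.
Proof. by move=> Pc g; rewrite -[g]word_reprK. Qed.

Lemma word_classP (u v : word I) :
  word_equiv u v <-> word_class u = word_class v.
Proof. by split=> [uv | /eqmodP /asboolP //]; apply/eqmodP/asboolP. Qed.

Lemma repr_word_class (u : word I) :
  word_equiv (repr (word_class u)) u.
Proof. by apply/word_classP; rewrite word_reprK. Qed.

Lemma word_classM (u v : word I) :
  presented_mul (word_class u) (word_class v) = word_class (u ++ v).
Proof. by apply/word_classP; apply: word_equiv_cat; apply: repr_word_class. Qed.

Lemma word_invV (u : word I) : word_equiv (u ++ word_inv u) [::].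
Proof.
elim: u => [|[x b] u IHu]; first exact: word_equiv_refl.
rewrite /word_inv map_cons rev_cons -cats1 -/(word_inv u) catA cat_cons -cat1s.
apply: word_equiv_trans (word_equiv_cancel x b).
apply: word_equiv_cat (word_equiv_refl [:: (x, b)]) _.
rewrite -[X in word_equiv _ X]cat0s.
by apply: word_equiv_cat IHu (word_equiv_refl _).
Qed.

Lemma word_invK : involutive word_inv.
Proof.
move=> u; rewrite /word_inv map_rev revK -map_comp map_id_in // => -[x b] _ /=.
by rewrite negbK.
Qed.

Lemma presented_mulA : associative presented_mul.
Proof.
by elim/word_class_ind=> u; elim/word_class_ind=> v; elim/word_class_ind=> w; rewrite !word_classM catA.
Qed.

Lemma presented_mul1 : left_id presented_one presented_mul.
Proof. by elim/word_class_ind=> u; rewrite word_classM. Qed.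

Lemma presented_mulr1 : right_id presented_one presented_mul.
Proof. by elim/word_class_ind=> u; rewrite word_classM cats0. Qed.

Lemma presented_mulV : left_inverse presented_one presented_inv presented_mul.
Proof.
move=> g; rewrite -{2}[g]word_reprK word_classM; apply/word_classP.
by rewrite -{2}[repr g]word_invK; apply: word_invV.
Qed.

Lemma presented_mulrV : right_inverse presented_one presented_inv presented_mul.
Proof. by move=> g; rewrite -{1}[g]word_reprK word_classM; apply/word_classP; apply: word_invV. Qed.

HB.instance Definition _ := isGroup.Build presented
  presented_mulA presented_mul1 presented_mulr1 presented_mulV presented_mulrV.

End Presentation.

Section Abelianization.
Local Open Scope group_scope.
Variable G : groupType.

Inductive commutator_subgroup : G -> Prop :=
| commutator_subgroup_comm x y : commutator_subgroup [~ x, y]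
| commutator_subgroup1 : commutator_subgroup 1
| commutator_subgroupM x y : commutator_subgroup x ->
    commutator_subgroup y -> commutator_subgroup (x * y)
| commutator_subgroupV x : commutator_subgroup x -> commutator_subgroup x^-1.

Lemma commutator_subgroupJ x y :
  commutator_subgroup x -> commutator_subgroup (x ^ y).
Proof.
move=> Dx; have -> : x ^ y = x * [~ x, y] by rewrite commgEl mulVKg.
by apply: commutator_subgroupM Dx (commutator_subgroup_comm x y).
Qed.

Definition ab_equiv (x y : G) : bool := `[< commutator_subgroup (x^-1 * y) >].

Fact ab_equiv_equiv : equiv_class_of ab_equiv.
Proof.
split=> [x | x y | y x z].
- by apply/asboolP; rewrite mulVg; apply: commutator_subgroup1.
- by apply/asboolP/asboolP => /commutator_subgroupV; rewrite invgM invgK.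
- move=> /asboolP xy /asboolP yz; apply/asboolP.
  by have := commutator_subgroupM xy yz; rewrite mulgA mulgK.
Qed.

Canonical ab_equiv_rel := EquivRelPack ab_equiv_equiv.

Definition abelianization : Type := {eq_quot ab_equiv}%qT.

HB.instance Definition _ := Choice.on abelianization.
HB.instance Definition _ := EqQuotient.on abelianization.

Definition ab_class (x : G) : abelianization := (\pi_abelianization x)%qT.

Definition ab_zero : abelianization := ab_class 1.
Definition ab_add (a b : abelianization) : abelianization := ab_class (repr a * repr b).
Definition ab_opp (a : abelianization) : abelianization := ab_class (repr a)^-1.

Lemma ab_reprK a : ab_class (repr a) = a.
Proof. exact: reprK. Qed.

Lemma ab_class_ind (P : abelianization -> Prop) :
  (forall x, P (ab_class x)) -> forall a, P a.
Proof. by move=> Pc a; rewrite -[a]ab_reprK. Qed.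

Lemma ab_classP (x y : G) :
  commutator_subgroup (x^-1 * y) <-> ab_class x = ab_class y.
Proof. by split=> [xy | /eqmodP /asboolP //]; apply/eqmodP/asboolP. Qed.

Lemma ab_classM (x y : G) :
  ab_add (ab_class x) (ab_class y) = ab_class (x * y).
Proof.
apply/ab_classP; set x' := repr _; set y' := repr _.
have Dx : commutator_subgroup (x'^-1 * x) by apply/ab_classP; rewrite ab_reprK.
have Dy : commutator_subgroup (y'^-1 * y) by apply/ab_classP; rewrite ab_reprK.
have -> : (x' * y')^-1 * (x * y) = (x'^-1 * x) ^ y' * (y'^-1 * y).
  by rewrite conjgE invgM !mulgA mulgK.
by apply: commutator_subgroupM Dy; apply: commutator_subgroupJ.
Qed.

Lemma ab_addA : associative ab_add.
Proof.
by elim/ab_class_ind=> x; elim/ab_class_ind=> y; elim/ab_class_ind=> z; rewrite !ab_classM mulgA.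
Qed.

Lemma ab_addC : commutative ab_add.
Proof.
elim/ab_class_ind=> x; elim/ab_class_ind=> y; rewrite !ab_classM; apply/ab_classP.
have -> : (x * y)^-1 * (y * x) = [~ y, x] by rewrite invgM commgEl conjgE !mulgA.
exact: commutator_subgroup_comm.
Qed.

Lemma ab_add0 : left_id ab_zero ab_add.
Proof. by elim/ab_class_ind=> x; rewrite ab_classM mul1g. Qed.

Lemma ab_addN : left_inverse ab_zero ab_opp ab_add.
Proof. by move=> a; rewrite -{2}[a]ab_reprK ab_classM mulVg. Qed.

HB.instance Definition _ := GRing.isZmodule.Build abelianization
  ab_addA ab_addC ab_add0 ab_addN.

End Abelianization.

Section Betti.
Import GRing.Theory Num.Theory.
Local Open Scope ring_scope.

(* beta(A) = b, that is, A is isomorphic to A0 (+) Z^b for some finite A0; such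
   a b is unique by has_betti_uniq, and exists when A is finitely generated. *)
Definition has_betti (A : zmodType) (b : nat) : Prop :=
  exists (A0 : finZmodType) (f : {additive A -> (A0 * 'rV[int]_b)%type}),
    bijective f.

Lemma int_row_kernel m n (M : 'M[int]_(m, n)) :
  (forall v : 'rV[int]_m, v *m M = 0 -> v = 0) -> (m <= n)%N.
Proof.
move=> injM; set Mq : 'M[rat]_(m, n) := map_mx intr M.
suff /eqP <- : row_free Mq by apply: rank_leq_col.
apply/row_freeP; apply/row_freeP/inj_row_free => u uM0.
pose d : int := \prod_k denq (u 0 k).
have d0 : d%:~R != 0 :> rat.
  by rewrite intr_eq0; apply/prodf_neq0 => k _; apply: denq_neq0.
pose a : 'rV[int]_m := \row_j (numq (u 0 j) * \prod_(k | k != j) denq (u 0 k)).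
have aE : map_mx intr a = d%:~R *: u :> 'rV[rat]_m.
  apply/rowP => j; rewrite !mxE /d [in RHS](bigD1 j) //= !intrM mulrAC; congr (_ * _).
  by rewrite mulrC numqE.
have a0 : a = 0.
  apply: injM; apply/rowP => j; apply: (@intr_inj rat).
  have : map_mx intr (a *m M) = 0 :> 'rV[rat]_n.
    by rewrite map_mxM /= aE -scalemxAl uM0 scaler0.
  by move/rowP/(_ j); rewrite !mxE.
have := aE; rewrite a0 map_mx0 => /esym/eqP.
by rewrite scaler_eq0 (negPf d0) => /eqP.
Qed.

Lemma finZmod_mulrn_card (A0 : finZmodType) (x : A0) : x *+ #|A0| = 0.
Proof.
apply: (addIr (\sum_y y)); rewrite add0r -sumr_const -big_split /=.
by rewrite [RHS](reindex_inj (addrI x)).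
Qed.

Lemma has_betti_leq (A : zmodType) (b c : nat) :
  has_betti A b -> has_betti A c -> (b <= c)%N.
Proof.
move=> [A0 [f [f' fK f'K]]] [A1 [g g_bij]].
have f'D x y : f' (x + y) = f' x + f' y.
  by apply: (can_inj fK); rewrite raddfD /= !f'K.
pose k (v : 'rV[int]_b) : A := f' (0, v).
have kD v w : k (v + w) = k v + k w.
  by rewrite /k -f'D; congr f'; congr pair; rewrite addr0.
have k0 : k 0 = 0 by apply: (addrI (k 0)); rewrite -kD !addr0.
have kN v n : k (v *+ n) = k v *+ n.
  by elim: n => [|n IHn]; rewrite ?mulr0n // !mulrS kD IHn.
have k_inj v : k v = 0 -> v = 0.
  by rewrite -k0 => /(can_inj f'K) [].
pose h v : 'rV[int]_c := (g (k v)).2.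
have hD v w : h (v + w) = h v + h w by rewrite /h kD raddfD.
have h0 : h 0 = 0 by rewrite /h k0 raddf0.
have hN v : h (- v) = - h v by apply: (addrI (h v)); rewrite -hD !subrr h0.
have hB : zmod_morphism h by move=> v w; rewrite hD hN.
have hZ : scalable h.
  pose hadd := GRing.isZmodMorphism.Build _ _ h hB.
  pose H : {additive 'rV[int]_b -> 'rV[int]_c} := HB.pack h hadd.
  by move=> z v; rewrite -[z]intz !scaler_int; apply: (raddfMz H).
have hL : linear h by move=> z v w; rewrite hD hZ.
pose hlin := GRing.isLinear.Build _ _ _ _ h hL.
pose H : {linear 'rV[int]_b -> 'rV[int]_c} := HB.pack h hlin.
apply: (@int_row_kernel _ _ (lin1_mx H)) => v.
rewrite mul_rV_lin1 /= => hv.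
have gkv : g (k v *+ #|A1|) = 0.
  rewrite raddfMn /= [g (k v)]surjective_pairing -/(h v) hv.
  by rewrite pairMnE /= finZmod_mulrn_card mul0rn.
have : k (v *+ #|A1|) = 0 by apply: (bij_inj g_bij); rewrite kN gkv raddf0.
move=> /k_inj /rowP vN; apply/rowP => j; have /eqP := vN j.
rewrite mulmxnE !mxE mulrn_eq0 => /orP[/eqP N0|/eqP //].
by have : (0 : A1) \in A1 by []; rewrite (card0_eq N0).
Qed.

Lemma has_betti_uniq (A : zmodType) (b c : nat) :
  has_betti A b -> has_betti A c -> b = c.
Proof.
by move=> Ab Ac; apply/eqP; rewrite eqn_leq !(has_betti_leq Ab Ac, has_betti_leq Ac Ab).
Qed.

End Betti.

(* The word x_{i+m} x_{i+m+1} ... x_{i+m+k-1}, subscripts mod n: iterating ordS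
   j times adds j modulo n. *)
Definition gen_run n (i : 'I_n) (m k : nat) : word 'I_n :=
  [seq (iter j (@ordS n) i, false) | j <- iota m k].

Definition gen_fib_rel (r n s : nat) (u v : word 'I_n) : Prop :=
  exists i : 'I_n, u = gen_run i 0 r /\ v = gen_run i r s.

Definition gen_fib_group (r n s : nat) : groupType := presented (@gen_fib_rel r n s).

(* Main.v *)
Require Import Defs.
From mathcomp Require Import boolp.
From HB Require Import structures.
From mathcomp Require Import all_boot all_order all_algebra all_field ring.

(* The abelianization is the cokernel of the integer circulant matrix of exponent
   differences, so by Smith normal form its Betti number is the corank of that
   matrix.  Over the algebraic numbers the Fourier matrix diagonalizes it, with
   eigenvalues f(w), w^n = 1, where
     f(t) = (1 + ... + t^(r-1)) - t^r (1 + ... + t^(s-1)).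
   Since (t - 1) f(t) = 2 t^r - 1 - t^(r+s), a root w <> 1 of f on the unit circle
   satisfies |1 + w^(r+s)| = 2, which forces w^r = w^s = 1; moreover f(1) = r - s.
   It remains to count the n-th roots of unity w with w^gcd(r,n,s) = 1. *)

Set Implicit Arguments.
Unset Strict Implicit.
Unset Printing Implicit Defensive.

Import Order.TTheory GRing.Theory Num.Theory.
Local Open Scope ring_scope.

(** * Cokernels of integer matrices and their Betti numbers *)

Lemma mxrank_diag (F : fieldType) n (d : 'rV[F]_n) :
  \rank (diag_mx d) = #|[pred i | d 0 i != 0]|.
Proof.
(* The row space is the direct sum of the coordinate lines at the nonzero entries. *)
have /eqmxP -> : (diag_mx d == \sum_(i | d 0 i != 0) <<delta_mx 0 i : 'rV[F]_n>>)%MS.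
  apply/andP; split.
    apply/row_subP => i; rewrite row_diag_mx.
    have [-> | di0] := eqVneq (d 0 i) 0; first by rewrite scale0r sub0mx.
    by apply/scalemx_sub/(sumsmx_sup i) => //; rewrite genmxE.
  apply/sumsmx_subP => i di0; rewrite genmxE.
  have -> : delta_mx 0 i = (d 0 i)^-1 *: row i (diag_mx d).
    by rewrite row_diag_mx scalerA mulVf // scale1r.
  exact/scalemx_sub/row_sub.
have /mxdirectP /= -> := @mxdirect_delta F _ [pred i | d 0 i != 0] n id (fun _ _ _ _ e => e).
rewrite (eq_bigr (fun=> 1%N)) ?sum1_card // => i _.
by rewrite genmxE mxrank_delta.
Qed.

(* Z^(size d) / diag(d), with the null entries of d contributing the free part;
   vectors are represented by functions of which only the first size d values matter. *)
Lemma cyclic_factors (d : seq int) :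
  exists (A0 : finZmodType) (g : (nat -> int) -> A0 * 'rV[int]_(count_mem 0 d)),
    [/\ forall u v, g (fun i => u i + v i) = g u + g v,
        forall t, exists u, g u = t &
        forall u, g u = 0 <-> forall i, (i < size d)%N -> (d`_i %| u i)%Z].
Proof.
elim: d => [|d0 d [A0 [g [gD g_surj gker]]]].
  exists 'I_1, (fun=> (0, 0)); split=> [u v | [a t] | u]; last by split.
    by congr pair; rewrite addr0.
  by exists (fun=> 0); rewrite [a]ord1 [t]thinmx0.
pose tl (u : nat -> int) i := u i.+1.
pose cons (z : int) (u : nat -> int) i := if i is j.+1 then u j else z.
have ker_cons (u : nat -> int) (P : Prop) : (P <-> (d0 %| u 0%N)%Z) ->
    (P /\ g (tl u) = 0) <-> (forall i, (i < size (d0 :: d))%N -> ((d0 :: d)`_i %| u i)%Z).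
  move=> PE; rewrite PE gker; split=> [[u0 ut] [|i] //|uP]; first exact: ut.
  by split; [apply: (uP 0%N) | move=> i; apply: (uP i.+1)].
have [d00 | d0n0] := eqVneq d0 0.
  subst d0; rewrite -[count_mem _ _]/(1 + count_mem (0 : int) d)%N.
  exists A0, (fun u => ((g (tl u)).1, row_mx (u 0%N)%:M (g (tl u)).2)).
  split=> [u v | [a t] | u].
  - rewrite [g _]gD; congr pair; rewrite -[RHS]/(row_mx _ _ + row_mx _ _).
    by rewrite add_row_mx raddfD.
  - have [u gu] := g_surj (a, rsubmx (t : 'rV_(1 + _))).
    exists (cons (t 0 0) u); rewrite [tl _]/= [g _]gu /=; congr pair.
    rewrite -[RHS](hsubmxK (t : 'rV_(1 + _))); congr row_mx.
    by apply/rowP=> i; rewrite !mxE ord1 /=; congr (t _ _); apply/val_inj.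
  - apply: iff_trans (ker_cons u (u 0%N = 0) _); last by rewrite dvd0z; split=> /eqP.
    case: (g (tl u)) => a t /=; split=> [[-> t0] | [u0 [-> ->]]].
      have /rowP/(_ 0) := congr1 (fun t : 'rV_(1 + _) => lsubmx t) t0.
      rewrite row_mxKl !mxE => u0; split=> //; congr pair.
      by have := congr1 (fun t : 'rV_(1 + _) => rsubmx t) t0; rewrite row_mxKr linear0.
    by rewrite u0; congr pair; rewrite raddf0 row_mx0.
rewrite [count_mem _ _]/= (negPf d0n0) add0n.
(* A nonzero head contributes Z/|d0|, encoded as ['I_p.+1]; [inZp 1] generates it even when |d0| =
   1, where it is 0. *)
pose p := `|d0|.-1; have pE : p.+1 = `|d0|%N by rewrite prednK // absz_gt0.
pose e : 'I_p.+1 := inZp 1.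
have eMn m : e *+ m = inZp m by rewrite Zp_mulrn; apply/val_inj => /=; rewrite modnMml mul1n.
pose B := HB.pack_for finZmodType ('I_p.+1 * A0)%type.
exists B, (fun u => ((e *~ u 0%N, (g (tl u)).1), (g (tl u)).2)).
split=> [u v | [[a b] t] | u].
- by rewrite [g _]gD mulrzDr.
- have [u gu] := g_surj (b, t); exists (cons (val a : nat) u).
  by rewrite [g _]gu /= -pmulrn eMn valZpK.
- apply: iff_trans (ker_cons u (e *~ u 0%N = 0) _).
    by case: (g (tl u)) => a t; split=> [[-> -> ->] | [-> [-> ->]]].
  have eM m : e *+ m = 0 <-> (`|d0| %| m)%N.
    rewrite eMn -pE; split=> [/(congr1 val)/= /eqP // | /eqP m0].
    exact/val_inj.
  rewrite dvdzE -eM; case: (intP (u 0%N)) => [|m|m] //.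
  by rewrite mulrNz abszN; split=> /eqP e0; apply/eqP; rewrite oppr_eq0 in e0 *.
Qed.

(** The map [p] makes [A] the quotient of Z^n by the row lattice of [M]. With M = L D R and L, R
    unimodular, v -> v R^-1 carries this lattice onto that of D, so [A] is a sum of cyclic groups
    and the corank of [M] counts the null entries of D. *)
Lemma smith_betti (A : zmodType) n (M : 'M[int]_n) (p : 'rV[int]_n -> A) :
    {morph p : u v / u + v} -> (forall a, exists v, p v = a) ->
    (forall v, p v = 0 <-> exists c, v = c *m M) ->
  has_betti A (n - \rank (map_mx intr M : 'M[rat]_n)).
Proof.
move=> pD p_surj pker.
have pB : {morph p : u v / u - v}.
  by move=> u v; apply/(addIr (p v)); rewrite -pD !subrK.
have [L Lu [R Ru [d _ ME]]] := int_Smith_normal_form M.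
pose D : 'rV[int]_n := \row_j d`_j.
have {}ME : M = L *m diag_mx D *m R.
  by rewrite ME; congr (_ *m _ *m _); apply/matrixP => i j; rewrite !mxE.
have map_free (B : 'M[int]_n) : B \in unitmx -> map_mx intr B \in @unitmx rat n.
  by rewrite !unitmxE det_map_mx; apply: rmorph_unit.
have -> : (n - \rank (map_mx intr M : 'M[rat]_n))%N = count_mem 0 (codom (D 0)).
  rewrite ME !map_mxM /= mxrankMfree ?row_free_unit ?map_free //.
  rewrite -mxrank_tr trmx_mul mxrankMfree ?row_free_unit ?unitmx_tr ?map_free //.
  rewrite mxrank_tr map_diag_mx mxrank_diag.
  rewrite -{1}[n]card_ord -(cardC [pred i | map_mx intr D 0 i != 0 :> rat]) addKn.
  rewrite -sum1_card count_map -sum1_count big_enum_cond; apply: eq_bigl => i /=.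
  by rewrite !inE negbK !mxE intr_eq0.
have [A0 [g [gD g_surj gker]]] := cyclic_factors (codom (D 0)).
rewrite size_codom card_ord in gker.
pose ext (v : 'rV[int]_n) (i : nat) := oapp (v 0) 0 (insub i).
have extE v (i : 'I_n) : ext v i = v 0 i by rewrite /ext valK.
have extD u v : ext (u + v) = fun i => ext u i + ext v i.
  by apply: funext => i; rewrite /ext; case: insub => [j|] /=; rewrite ?mxE ?addr0.
pose G v := g (ext (v *m invmx R)).
have GD : {morph G : u v / u + v} by move=> u v; rewrite /G mulmxDl extD gD.
have GB : {morph G : u v / u - v}.
  by move=> u v; apply/(addIr (G v)); rewrite -GD !subrK.
have G_surj t : exists v, G v = t.
  have [u <-] := g_surj t; exists ((\row_j u j) *m R); rewrite /G mulmxK //.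
  (* The functions [e] and [u] agree below n, which is all that [g] sees. *)
  set e := ext _; pose w i := e i - u i.
  have w0 : g w = 0.
    apply/gker => i ltin; rewrite /w /e -[i]/(val (Ordinal ltin)) extE mxE subrr.
    exact: dvdz0.
  rewrite -[RHS]addr0 -w0 -gD; congr g.
  by apply: funext => i; rewrite /w addrC subrK.
have Gker v : G v = 0 <-> p v = 0.
  rewrite pker gker; split=> [dvdv | [c ->] i ltin].
    (* At a null invariant factor, divisibility forces the coordinate to be 0, which agrees with the
       default quotient 0. *)
    pose q : 'rV[int]_n := \row_i divz ((v *m invmx R) 0 i) d`_i.
    exists (q *m invmx L); rewrite ME -!mulmxA mulKmx // mulmxA.
    apply: (canRL (mulmxKV Ru)); apply/rowP => i; rewrite mul_mx_diag !mxE divzK //.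
    by have := dvdv i (ltn_ord i); rewrite extE (nth_map i) ?size_enum_ord // nth_ord_enum !mxE.
  pose i0 := Ordinal ltin; rewrite -[i]/(val i0) extE (nth_map i0) ?size_enum_ord // nth_ord_enum.
  by rewrite ME !mulmxA mulmxK // mul_mx_diag !mxE dvdz_mull.
(* Since [p] and [G] are surjections with the same kernel, composing each with any section of the
   other gives inverse isomorphisms. *)
have [pinv pinvK] := choice p_surj; have [Ginv GinvK] := choice G_surj.
have GpE v w : G v = G w <-> p v = p w.
  have eq_sub (B : zmodType) (a b : B) : a = b <-> a - b = 0.
    by split=> [->|/eqP]; rewrite ?subrr ?subr_eq0 // => /eqP.
  by rewrite (eq_sub _ (G v)) -GB Gker pB -eq_sub.
pose f a := G (pinv a).
have fB : zmod_morphism f by move=> a b; rewrite /f -GB; apply/GpE; rewrite pB !pinvK.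
have f_inj : injective f by move=> a b /GpE; rewrite !pinvK.
exists A0, (HB.pack_for {additive A -> (A0 * 'rV[int]_(count_mem 0 (codom (D 0))))%type} f
  (GRing.isZmodMorphism.Build _ _ f fB)).
have fK : cancel (p \o Ginv) f.
  by move=> t; rewrite -[RHS]GinvK /f; apply/GpE; rewrite pinvK.
by exists (p \o Ginv) => //; apply: inj_can_sym.
Qed.

(** * Abelianization of a balanced presentation *)

Definition exponents n (w : word 'I_n) : 'rV[int]_n :=
  \sum_(a <- w) (-1) ^+ a.2 *: delta_mx 0 a.1.

Lemma exponents_cat n (u v : word 'I_n) :
  exponents (u ++ v) = exponents u + exponents v.
Proof. exact: big_cat. Qed.

Lemma exponents_surj n (v : 'rV[int]_n) : exists w, exponents w = v.
Proof.
exists (flatten [seq nseq `|v 0 i| (i, v 0 i < 0) | i <- enum 'I_n]).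
rewrite [RHS]row_sum_delta /exponents big_flatten big_map big_enum.
apply: eq_bigr => i _; rewrite big_nseq iter_addr_0 /= [in RHS](intEsign (v 0 i)).
by rewrite scalerMnl -mulr_natr natz.
Qed.

(** The map [p] sends the basis of Z^n to the generators, and its kernel is the row lattice [N] of
    [M]: rows die because the relations hold; conversely, exponents modulo [N] are well defined on
    group elements and vanish on commutators. *)
Lemma balanced_presentation_betti n (U V : 'I_n -> word 'I_n) :
  has_betti (abelianization (presented (fun u v => exists i, u = U i /\ v = V i)))
    (n - \rank (map_mx intr (\matrix_i (exponents (U i) - exponents (V i))) : 'M[rat]_n)).
Proof.
set rels := fun u v => _; set M := \matrix_i _.
pose cl w : abelianization (presented rels) := ab_class (word_class rels w).
have cl_cat u v : cl (u ++ v) = cl u + cl v.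
  by rewrite /cl -word_classM -ab_classM.
have clE u v : word_equiv rels u v -> cl u = cl v by rewrite /cl => /word_classP ->.
have cl0 : cl [::] = 0 by [].
pose x i := cl [:: (i, false)].
have clV i : cl [:: (i, true)] = - x i.
  by apply/eqP; rewrite -addr_eq0 -cl_cat -cl0; apply/eqP/clE/word_equiv_cancel.
pose p (v : 'rV[int]_n) := \sum_i x i *~ v 0 i.
have pD : {morph p : u v / u + v}.
  by move=> u v; rewrite /p -big_split; apply: eq_bigr => i _; rewrite mxE mulrzDr.
have p0 : p 0 = 0 by apply: (addIr (p 0)); rewrite -pD !add0r.
have pB : {morph p : u v / u - v}.
  by move=> u v; apply/(addIr (p v)); rewrite -pD !subrK.
have pZ z v : p (z *: v) = p v *~ z.
  by rewrite /p mulrz_suml; apply: eq_bigr => i _; rewrite mxE mulrC mulrzA.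
have p_delta i : p (delta_mx 0 i) = x i.
  rewrite /p (bigD1 i) //= mxE !eqxx big1 ?addr0 // => j /negPf ji.
  by rewrite mxE ji.
have pE w : p (exponents w) = cl w.
  elim: w => [|[i b] w IHw]; first by rewrite /exponents big_nil p0.
  rewrite -cat1s exponents_cat pD IHw cl_cat /exponents big_seq1 pZ p_delta /=.
  by case: b; rewrite ?clV // expr1 mulrNz.
have p_surj a : exists v, p v = a.
  elim/ab_class_ind: a => g; elim/word_class_ind: g => w.
  by exists (exponents w); apply: pE.
pose N (v : 'rV[int]_n) := exists c, v = c *m M.
have ND u v : N u -> N v -> N (u + v).
  by move=> [c ->] [c' ->]; exists (c + c'); rewrite mulmxDl.
have NN u : N u -> N (- u) by move=> [c ->]; exists (- c); rewrite mulNmx.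
have N0 : N 0 by exists 0; rewrite mul0mx.
have Nequiv u v : word_equiv rels u v -> N (exponents u - exponents v).
  elim=> {u v} [u | u v _ | u v w _ uv _ vw | u u' v v' _ uu' _ vv' | i b | u v [i [-> ->]]].
  - by rewrite subrr.
  - by move/NN; rewrite opprB.
  - by have := ND _ _ uv vw; rewrite addrA subrK.
  - by rewrite !exponents_cat opprD addrACA; apply: ND.
  - rewrite /exponents big_cons big_seq1 big_nil subr0 /= -scalerDl.
    by case: b; rewrite /= ?addNr ?subrr scale0r.
  - by exists (delta_mx 0 i); rewrite -rowE rowK.
(* As [repr] picks an arbitrary word, [e] is a homomorphism only modulo [N]. *)
pose e (g : presented rels) := exponents (repr g).
have Nrepr w : N (e (word_class rels w) - exponents w) by apply/Nequiv/repr_word_class.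
have Nsub u v : N (u - v) -> N v -> N u by move=> uv v0; rewrite -[u](subrK v); apply: ND.
have NeM g h : N (e (g * h)%g - (e g + e h)).
  by have := Nrepr (repr g ++ repr h); rewrite exponents_cat.
have Ne1 : N (e 1%g) by have := Nrepr [::]; rewrite /exponents big_nil subr0.
have NeV g : N (e g^-1%g + e g).
  have := NeM g^-1%g g; rewrite mulVg => /NN; rewrite opprB => /Nsub; exact.
have Ncomm g : commutator_subgroup g -> N (e g).
  elim=> {g} [g h | | g h _ Ng _ Nh | g _ Ng] //.
  - rewrite commgEl conjgE; apply: Nsub (NeM _ _) _.
    (* Here [g, h] = g^-1 (h^-1 (g h)); the exponents of g and h cancel against those of their
       inverses. *)
    have := ND _ _ (ND _ _ (NeM h^-1%g (g * h)%g) (NeM g h)) (ND _ _ (NeV g) (NeV h)).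
    by congr N; apply/rowP=> j; rewrite !mxE; ring.
  - by apply: Nsub (NeM _ _) (ND _ _ Ng Nh).
  - by rewrite -[e _](addrK (e g)); apply/ND/NN.
apply: (@smith_betti _ _ M p pD p_surj) => v; split=> [|[c ->]].
  (* A kernel vector is the exponent vector of a word whose class lies in the commutator
     subgroup. *)
  have [w <-] := exponents_surj v; rewrite pE -cl0 => /esym/ab_classP.
  rewrite invg1 mul1g => /Ncomm Nw.
  by rewrite -[exponents w](subKr (e (word_class rels w))); apply: ND => //; apply: NN.
rewrite mulmx_sum_row; elim/big_ind: _ => // [u w u0 w0 | i _]; first by rewrite pD u0 w0 addr0.
rewrite pZ rowK pB !pE (clE (U i) (V i)) ?subrr ?mul0rz //.
by apply: word_equiv_rel; exists i.
Qed.

(** * Zeros of f on the unit circle *)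

Lemma sum_unit_circle (a b : algC) : `|a| = 1 -> `|b| = 1 ->
  2 * a = 1 + b -> a = 1 /\ b = 1.
Proof.
(* This is the equality case of the triangle inequality, so 1 and b have the same direction. *)
move=> a1 b1 ab; have : `|1 + b| = `|1| + `|b| by rewrite -ab normrM a1 b1 normr1 normr_nat mulr1.
case/normCDeq => t _ []; rewrite normr1 b1 !mul1r => t1 bt.
have b1' : b = 1 by rewrite bt -t1.
by split=> //; apply: (@mulfI _ 2); rewrite ?pnatr_eq0 // ab b1' mulr1.
Qed.

(** The value of f at [w], split into sums over the index ranges that [gen_run] uses. *)
Definition run_diff (R : pzRingType) r s (w : R) : R :=
  \sum_(j <- iota 0 r) w ^+ j - \sum_(j <- iota r s) w ^+ j.

Lemma run_diff_root n r s (w : algC) : (0 < n)%N -> w ^+ n = 1 -> w != 1 ->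
  (run_diff r s w == 0) = (w ^+ r == 1) && (w ^+ s == 1).
Proof.
move=> n0 wn w1; have w_norm : `|w| = 1.
  by apply/eqP; rewrite -(pexpr_eq1 n0) // -normrX wn normr1.
have sum0 m : (w - 1) * \sum_(j <- iota 0 m) w ^+ j = w ^+ m - 1.
  by rewrite subrX1 -(big_mkord xpredT (fun j => w ^+ j)) /index_iota subn0.
have -> : (run_diff r s w == 0) = (2 * w ^+ r == 1 + w ^+ (r + s)).
  have w10 : w - 1 != 0 by rewrite subr_eq0.
  rewrite -[LHS](inj_eq (mulfI w10)) mulr0 mulrBr sum0.
  (* Shifting the second run to start at 0 factors out w^r; both geometric sums then telescope. *)
  rewrite -[X in iota X s]addn0 iotaDl big_map.
  under eq_bigr do rewrite exprD.
  rewrite -mulr_sumr mulrCA sum0 -[RHS]subr_eq0 exprD; congr (_ == 0); ring.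
apply/eqP/andP => [e | [/eqP wr /eqP ws]]; last by rewrite exprD wr ws !mulr1.
have [] := sum_unit_circle _ _ e; rewrite ?normrX ?w_norm ?expr1n // => wr.
by rewrite exprD wr mul1r => ->.
Qed.

(** * Fourier diagonalization of the relation matrix *)

Lemma expr_iter_ordS (R : pzRingType) (w : R) n j (i : 'I_n) :
  w ^+ n = 1 -> w ^+ iter j (@ordS n) i = w ^+ (i + j).
Proof.
by move=> wn; elim: j => [|j IHj]; rewrite ?addn0 //= expr_mod // exprS IHj -exprS addnS.
Qed.

(* The Fourier matrix (z^(jk)) diagonalizes the circulant relation matrix. *)
Lemma gen_fib_rank r s n : (0 < n)%N -> forall z : algC, n.-primitive_root z ->
  (n - \rank (map_mx intr (\matrix_i (exponents (@gen_run n i 0 r)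
                                      - exponents (gen_run i r s))) : 'M[rat]_n))%N
  = #|[pred k : 'I_n | run_diff r s (z ^+ k) == 0]|.
Proof.
move=> n0 z zP; set M := \matrix_i _.
pose V : 'M[algC]_n := Vandermonde n (\row_k z ^+ k).
pose d := \row_(k < n) run_diff r s (z ^+ k).
have V_unit : V \in unitmx.
  (* The nodes z^k with k < n are distinct because z is primitive. *)
  rewrite unitmxE det_Vandermonde unitfE; apply/prodf_neq0 => i _.
  apply/prodf_neq0 => j ij; rewrite !mxE subr_eq0 (eq_prim_root_expr zP) !modn_small //.
  by rewrite gtn_eqF.
have runE i m t k : (map_mx intr (exponents (@gen_run n i m t)) *m V) 0 k
    = z ^+ (i * k) * \sum_(j <- iota m t) (z ^+ k) ^+ j.
  rewrite /exponents /gen_run big_map mulr_sumr raddf_sum mulmx_suml summxE.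
  apply: eq_bigr => j _; rewrite /= expr0 scale1r map_delta_mx -rowE !mxE.
  have zkn : (z ^+ k) ^+ n = 1 by rewrite exprAC (prim_expr_order zP) expr1n.
  by rewrite expr_iter_ordS // exprD -!exprM mulnC.
(* Column k of [V] is an eigenvector with eigenvalue f(z^k). *)
have MV : map_mx intr M *m V = V *m diag_mx d.
  apply/row_matrixP => i; rewrite row_mul -map_row rowK raddfB mulmxBl.
  by apply/rowP => k; rewrite mxE [X in _ + X]mxE !runE mul_mx_diag !mxE -mulrBr -exprM mulnC.
have -> : \rank (map_mx intr M : 'M[rat]_n) = #|[pred k | d 0 k != 0]|.
  (* Extending scalars from the rationals to [algC] preserves the rank. *)
  rewrite -(mxrank_map (@ratr algC)) -map_mx_comp.
  have -> : map_mx (ratr \o intr) M = map_mx intr M :> 'M[algC]_n.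
    by apply/matrixP => i j; rewrite !mxE /= ratr_int.
  rewrite -(@mxrankMfree _ _ _ _ _ V) ?row_free_unit // MV -mxrank_tr trmx_mul.
  by rewrite mxrankMfree ?row_free_unit ?unitmx_tr // mxrank_tr mxrank_diag.
rewrite -{1}[n]card_ord -(cardC [pred k | d 0 k != 0]) addKn.
by apply: eq_card => k; rewrite !inE negbK mxE.
Qed.

(** * Counting the roots of unity that annihilate f *)

Lemma card_dvdn_ord n m : (m %| n)%N ->
  #|[pred k : 'I_n | (m %| k)%N]| = (n %/ m)%N.
Proof.
move=> mn; rewrite divn_count_dvd -sum1_card big_mkcond.
(* The known count runs over 1..n, the wanted one over 0..n-1; both are completed to 0..n, whose two
   endpoints are multiples of m. *)
apply: (@addIn 1%N); transitivity (\sum_(0 <= i < n.+1) (m %| i))%N.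
  by rewrite big_nat_recr //= mn -(big_mkord xpredT (fun i => (m %| i)%N : nat)).
by rewrite big_nat_recl // dvdn0 big_add1 addnC.
Qed.

(** The k with (z^k)^g = 1 are the g multiples of n/g. Only k = 0 can deviate: as f(1) = r - s, it
    drops out exactly when r and s differ, whence the subtracted boolean. *)
Lemma card_run_diff_roots r s n (z : algC) : (0 < s)%N -> (0 < n)%N ->
    n.-primitive_root z ->
  #|[pred k : 'I_n | run_diff r s (z ^+ k) == 0]|
    = (gcdn (gcdn r n) s - (r != s))%N.
Proof.
move=> s0 n0 zP; set g := gcdn (gcdn r n) s.
have g0 : (0 < g)%N by rewrite gcdn_gt0 s0 orbT.
have gn : (g %| n)%N by rewrite (dvdn_trans (dvdn_gcdl _ _)) // dvdn_gcdr.
have z1 (k : 'I_n) : (z ^+ k == 1) = (k == 0%N :> nat).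
  by rewrite -(prim_order_dvd zP) /dvdn modn_small.
have zg (k : 'I_n) : ((z ^+ k) ^+ r == 1) && ((z ^+ k) ^+ s == 1) = (n %/ g %| k)%N.
  (* n divides both kr and ks iff it divides gcd(kr, kn, ks) = kg. *)
  rewrite -!exprM -!(prim_order_dvd zP) dvdn_divLR // !muln_gcdr !dvdn_gcd.
  by rewrite (dvdn_mull k (dvdnn n)) andbT.
have card_g : #|[pred k : 'I_n | n %/ g %| k]%N| = g.
  by rewrite card_dvdn_ord ?dvdn_div // divnA // mulKn.
have f1 : (run_diff r s (1 : algC) == 0) = (r == s).
  rewrite /run_diff; under eq_bigr do rewrite expr1n.
  under [X in _ - X]eq_bigr do rewrite expr1n.
  by rewrite !big_const_seq !count_predT !size_iota !iter_addr_0 subr_eq0 eqr_nat.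
have fE (k : 'I_n) : k != 0%N :> nat -> (run_diff r s (z ^+ k) == 0) = (n %/ g %| k)%N.
  move=> k0; rewrite (run_diff_root _ _ n0) ?zg ?z1 //.
  by rewrite exprAC (prim_expr_order zP) expr1n.
have [rs | /negPf rs] := eqVneq r s; last first.
  rewrite -card_g [in RHS](cardD1 (Ordinal n0)) inE dvdn0 addKn.
  apply: eq_card => k; rewrite !inE -val_eqE /=.
  by have [k0 | /fE //] := eqVneq (k : nat) 0%N; rewrite k0 f1 rs.
rewrite subn0 -[RHS]card_g; apply: eq_card => k; rewrite !inE.
by have [k0 | /fE //] := eqVneq (k : nat) 0%N; rewrite k0 f1 rs eqxx dvdn0.
Qed.

Local Close Scope ring_scope.

Theorem theorem3 (r n s : nat) (hr : 1 <= r) (hs : 1 <= s) (hn : 2 <= n) :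
  (r <> s -> has_betti (abelianization (gen_fib_group r n s)) (gcdn (gcdn r n) s - 1)) /\
  (r = s -> has_betti (abelianization (gen_fib_group r n s)) (gcdn r n)).
Proof.
have n0 : 0 < n by apply: ltnW.
have [z zP] := C_prim_root_exists n0.
have Abetti := @balanced_presentation_betti n (fun i => gen_run i 0 r) (fun i => gen_run i r s).
rewrite (gen_fib_rank r s n0 zP) card_run_diff_roots // in Abetti.
split=> [/eqP rs | rs]; first by rewrite rs in Abetti.
rewrite rs eqxx subn0 (gcdn_idPl _) in Abetti; first by rewrite rs.
exact: dvdn_gcdl.
Qed.
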